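(* There exists a Steinitz-Rademacher polyhedron (a model of the theory $\mathsf{SR}$ described in the context) whose domain has exactly 6 elements, and there is no Steinitz-Rademacher polyhedron whose domain has fewer than 6 elements.
   Context: Let $\pi$ be the unsorted first-order signature with equality consisting of three unary predicates $V$ (''vertex''), $E$ (''edge''), $F$ (''face'') and one binary relation $I$ (''incidence''). The theory $\mathsf{SR}$ consists of the following $\pi$-sentences: (1) there is at least one vertex, at least one edge, and at least one face; (2) every element satisfies $V$, $E$, or $F$; (3) $I$ is symmetric; (4) no two vertices are incident with each other, no two edges are incident with each other, and no two faces are incident with each other; (5) for all $v,e,f$, if $V(v)$, $E(e)$, $F(f)$, $I(v,e)$ and $I(e,f)$, then $I(v,f)$; (6) every edge is incident with exactly two vertices; (7) every edge is incident with exactly two faces; (8) whenever $V(v)$, $F(f)$ and $I(v,f)$, there are exactly two edges incident with both $v$ and $f$; (9) every vertex and every face is incident with at least one other element. A Steinitz-Rademacher polyhedron is a $\pi$-structure satisfying all sentences of $\mathsf{SR}$; its cardinality is the cardinality of its domain. *)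

(* Defs.v *)
From mathcomp Require Import all_boot.
From mathcomp Require Import classical_sets cardinality.
Set Implicit Arguments.
Unset Strict Implicit.
Unset Printing Implicit Defensive.

Record pi_structure := PiStructure {
  domain :> Type;
  V : domain -> Prop;
  E : domain -> Prop;
  F : domain -> Prop;
  I : domain -> domain -> Prop }.

Arguments V {_}.
Arguments E {_}.
Arguments F {_}.
Arguments I {_}.

Definition exactly_two (T : Type) (P : T -> Prop) : Prop :=
  exists x y : T,
    [/\ x <> y, P x, P y & forall z : T, P z -> z = x \/ z = y].

(* As in the first-order theory, V, E and F are not assumed to be disjoint, and
   SR_V, SR_E, SR_F include the case x = y (nothing is incident with itself). *)
Record SR (M : pi_structure) : Prop := {
  SR_nonempty : [/\ exists v : M, V v, exists e : M, E e & exists f : M, F f];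
  SR_cover : forall x : M, [\/ V x, E x | F x];
  SR_sym : forall x y : M, I x y -> I y x;
  SR_V : forall x y : M, V x -> V y -> ~ I x y;
  SR_E : forall x y : M, E x -> E y -> ~ I x y;
  SR_F : forall x y : M, F x -> F y -> ~ I x y;
  SR_trans : forall v e f : M, V v -> E e -> F f -> I v e -> I e f -> I v f;
  SR_edge_V : forall e : M, E e -> exactly_two (fun v : M => V v /\ I e v);
  SR_edge_F : forall e : M, E e -> exactly_two (fun f : M => F f /\ I e f);
  SR_VF : forall v f : M, V v -> F f -> I v f ->
    exactly_two (fun e : M => [/\ E e, I e v & I e f]);
  SR_incident : forall x : M, V x \/ F x -> exists y : M, y <> x /\ I x y }.

Definition has_cardinality (M : pi_structure) (n : nat) : Prop :=
  ([set: M] #= `I_n)%classic%card.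

(* Main.v *)
(** An edge is incident with two vertices and two faces, and axiom (5) makes each
    of these vertices incident with each of these faces; since nothing is incident
    with itself, all five are distinct even though V, E and F may overlap. Axiom
    (8), applied to one such vertex and face, yields a second edge, hence six
    elements. Conversely, two vertices, two edges and two faces, with elements of
    different kinds always incident, form a model. *)
Require Import Defs.
From Stdlib Require List.
From mathcomp Require Import all_boot.
From mathcomp Require Import classical_sets functions cardinality.

Set Implicit Arguments.
Unset Strict Implicit.
Unset Printing Implicit Defensive.

Lemma SR_irrefl (M : pi_structure) : SR M -> forall x : M, ~ I x x.
Proof.
move=> H x; case: (SR_cover H x) => Hx;
  [exact: (SR_V H) | exact: (SR_E H) | exact: (SR_F H)].
Qed.

(** Axiom (6) supplies a vertex incident with [x], which axiom (4) forbids when [x] is itself a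
    vertex. *)
Lemma SR_edge_notV (M : pi_structure) : SR M -> forall x : M, E x -> ~ V x.
Proof.
move=> H x Ex Vx; have [v [_ [_ [Vv Ixv] _ _]]] := SR_edge_V H Ex.
exact: (SR_V H Vx Vv Ixv).
Qed.

Lemma SR_edge_notF (M : pi_structure) : SR M -> forall x : M, E x -> ~ F x.
Proof.
move=> H x Ex Fx; have [f [_ [_ [Ff Ixf] _ _]]] := SR_edge_F H Ex.
exact: (SR_F H Fx Ff Ixf).
Qed.

Lemma exactly_two_other (T : Type) (P : T -> Prop) (x : T) :
  exactly_two P -> P x -> exists y, x <> y /\ P y.
Proof.
move=> [a [b [ab Pa Pb ub]]] Px.
by case: (ub _ Px) => ->; [exists b | exists a; split=> // /esym].
Qed.

(** [List.NoDup] replaces [uniq] because the domain is a bare [Type], without boolean equality. *)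
Lemma SR_six (M : pi_structure) : SR M ->
  exists s : seq M, size s = 6 /\ List.NoDup s.
Proof.
move=> H; have [_ [e Ee] _] := SR_nonempty H.
have [v [v' [vv' [Vv Iev] [Vv' Iev'] _]]] := SR_edge_V H Ee.
have [f [f' [ff' [Ff Ief] [Ff' Ief'] _]]] := SR_edge_F H Ee.
(* Axiom (5) compares a vertex with a face around a common edge, so the two are separated only for
   elements incident with [e]. *)
have VneF x y : V x -> I e x -> F y -> I e y -> x <> y.
  move=> Vx Iex Fy Iey xy.
  have := SR_trans H Vx Ee Fy (SR_sym H Iex) Iey.
  by rewrite xy; apply: SR_irrefl H y.
have EneV (x y : M) : E x -> V y -> x <> y.
  by move=> Ex Vy xy; case: (SR_edge_notV H Ex); rewrite xy.
have EneF (x y : M) : E x -> F y -> x <> y.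
  by move=> Ex Fy xy; case: (SR_edge_notF H Ex); rewrite xy.
have Ivf := SR_trans H Vv Ee Ff (SR_sym H Iev) Ief.
have [e' [ee' [Ee' _ _]]] :=
  exactly_two_other (SR_VF H Vv Ff Ivf) (And3 Ee Iev Ief).
(* In this order, each of the 15 inequalities is a hypothesis (same kind) or an instance of [EneV],
   [EneF] or [VneF]. *)
exists [:: e; e'; v; v'; f; f']; split=> //.
have notin0 (x : M) : ~ List.In x [::] by [].
have notin_cons (x y : M) s : x <> y -> ~ List.In x s -> ~ List.In x (y :: s).
  by move=> xy xs [/esym|].
repeat apply: List.NoDup_cons; last exact: List.NoDup_nil.
all: repeat apply: (@notin_cons _ _ _); try done.
all: by [apply: EneV | apply: EneF | apply: VneF].
Qed.

(** The bijection [g] carries [s] injectively into [iota 0 n], where [uniq] makes sense and lengths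
    can be compared. *)
Lemma NoDup_size_le_card (M : pi_structure) (n : nat) (s : seq M) :
  has_cardinality M n -> List.NoDup s -> size s <= n.
Proof.
move=> /card_set_bijP [g [gn ginj _]] us.
have ginj' : injective g by move=> x y gxy; apply: ginj; rewrite ?inE.
rewrite -(size_map g) -[n in _ <= n](size_iota 0).
apply: uniq_leq_size.
  elim: us => //= x l xl _ ->; rewrite andbT; apply/negP.
  move=> gxl; apply: xl; elim: l gxl => //= y l IH.
  by rewrite inE => /predU1P[/ginj'->|/IH]; [left|right].
move=> k; rewrite mem_iota /= add0n.
elim: s {us} => //= x l IH; rewrite inE => /predU1P[->|//].
exact: gn.
Qed.

Lemma card_finType (T : finType) : ([set: T] #= `I_#|T|)%classic%card.
Proof.
apply/card_set_bijP; exists (fun x => enum_rank x : nat); split.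
- by move=> x _ /=.
- by move=> x y _ _ /val_inj/enum_rank_inj.
- by move=> k /= kT; exists (enum_val (Ordinal kT)); rewrite ?enum_valK.
Qed.

(** Geometrically, a digon drawn on the sphere: two vertices joined by two edges, which bound two
    faces. *)
Definition six_polyhedron : pi_structure :=
  @PiStructure ('I_3 * bool)
    (fun x => x.1 = 0 :> nat) (fun x => x.1 = 1 :> nat) (fun x => x.1 = 2 :> nat)
    (fun x y => x.1 <> y.1 :> nat).

(** Settles axioms (6), (7) and (8) in the model: elements of different kinds are always incident,
    so each condition there only fixes the kind. *)
Lemma exactly_two_fiber (n k : nat) (P : 'I_n * bool -> Prop) : k < n ->
  (forall x, P x <-> x.1 = k :> nat) -> exactly_two P.
Proof.
move=> kn Pk; exists (Ordinal kn, true), (Ordinal kn, false).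
split; [by [] | exact/Pk | exact/Pk |].
move=> [i b] /Pk /= ik; have -> : i = Ordinal kn by exact: val_inj.
by case: b; [left | right].
Qed.

Lemma six_polyhedron_SR : SR six_polyhedron.
Proof.
split=> /=.
- by split; [exists (@Ordinal 3 0 isT, true) | exists (@Ordinal 3 1 isT, true)
            | exists (@Ordinal 3 2 isT, true)].
- move=> [[[|[|[|//]]] lti] b] /=.
  + exact: Or31.
  + exact: Or32.
  + exact: Or33.
- by move=> x y xy /esym.
- by move=> x y -> ->.
- by move=> x y -> ->.
- by move=> x y -> ->.
- by move=> v e f -> _ ->.
- move=> e Ee; apply: (@exactly_two_fiber 3 0) => // x; rewrite Ee.
  by split=> [[]|->].
- move=> e Ee; apply: (@exactly_two_fiber 3 2) => // x; rewrite Ee.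
  by split=> [[]|->].
- move=> v f Vv Ff _; apply: (@exactly_two_fiber 3 1) => // x; rewrite Vv Ff.
  by split=> [[]|->].
- move=> x VFx; exists (@Ordinal 3 1 isT, true).
  by split=> [xE|]; case: VFx; rewrite -?xE // => ->.
Qed.

Lemma six_polyhedron_card : has_cardinality six_polyhedron 6.
Proof.
have <- : #|{: 'I_3 * bool}| = 6 by rewrite card_prod card_ord card_bool.
exact: card_finType.
Qed.

Theorem theorem4 :
  (exists M : pi_structure, SR M /\ has_cardinality M 6) /\
  ~ (exists (M : pi_structure) (n : nat),
       [/\ SR M, has_cardinality M n & n < 6]).
Proof.
split.
  by exists six_polyhedron; split;
    [exact: six_polyhedron_SR | exact: six_polyhedron_card].
move=> [M [n [HM Mn]]]; have [s [<- us]] := SR_six HM.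
by rewrite ltnNge (NoDup_size_le_card Mn us).
Qed.
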